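(* Let $D\subset V$ be a bounded convex domain in a Banach space $V$, and let $(D,d)$ be a $(1,\kappa)$-quasi-geodesic metric space (for some $\kappa\ge0$), whose topology coincides with the norm topology, satisfying Axiom $1'$ and Axiom $2^{\ast}$. Suppose that $f:D\to D$ is a compact nonexpansive mapping without bounded orbits. Then there exists $\xi\in\partial D$ such that $$\Omega_f\subset\mathrm{ch}(\xi).$$
   Context: $\overline{D}$ is the closure of $D$ in the norm topology and $\partial D=\overline{D}\setminus D$; $[x,y]$ denotes the closed line segment. $(D,d)$ is $(1,\kappa)$-quasi-geodesic if every pair of points of $D$ can be connected by a curve $\gamma:[a,b]\to D$ with $|t_1-t_2|-\kappa\le d(\gamma(t_1),\gamma(t_2))\le|t_1-t_2|+\kappa$ for all $t_1,t_2\in[a,b]$. Axiom $1'$ (here with ambient space $(\overline{D},\|\cdot\|)$): the topology of $d$ on $D$ coincides with the norm topology, and for any $w\in D$, if $\{x_n\}\subset D$ converges in norm to a point of $\partial D$, then $d(x_n,w)\to\infty$. Axiom $2^{\ast}$: if $\{x_n\}$ and $\{y_n\}$ are sequences in $D$ converging (in norm) to $x$ and $y$ in $\partial D$, respectively, and $[x,y]\nsubseteq\partial D$, then for each $z\in D$, $\lim_{n\to\infty}[d(x_n,y_n)-\max\{d(x_n,z),d(y_n,z)\}]=\infty$. $f:D\to D$ is nonexpansive if $d(f(x),f(y))\le d(x,y)$ for all $x,y\in D$; it is compact if the norm closure of $f(D)$ is compact in $\overline{D}$. ''Without bounded orbits'' means that no orbit $\{f^n(y):n\in\mathbb{N}\}$,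 $y\in D$, is $d$-bounded. Attractor: $\Omega_f=\bigcup_{y\in D}\omega_f(y)$, where $\omega_f(y)$ is the set of $x\in\overline{D}$ for which there is an increasing sequence $\{n_k\}$ with $\lim_{k\to\infty}f^{n_k}(y)=x$ in norm. For $\xi\in\partial D$: $\mathrm{ch}(\xi)=\{x\in\partial D:[x,\xi]\subset\partial D\}$. *)

(* Defs.v *)
From HB Require Import structures.
From mathcomp Require Import all_boot all_order all_algebra.
From mathcomp Require Import all_classical all_reals all_analysis.

Set Implicit Arguments.
Unset Strict Implicit.
Unset Printing Implicit Defensive.

Import Order.TTheory GRing.Theory Num.Theory.
Import numFieldNormedType.Exports.

Local Open Scope classical_set_scope.
Local Open Scope ring_scope.

(* A metric space (D, d) on a subset D of V is given by a function
   d : V -> V -> R of which only the values on D x D matter; likewise a map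
   D -> D is a function f : V -> V with [set_fun D D f]. *)

Section definitions.
Context {R : realType} {V : completeNormedModType R}.
Implicit Types (D A U W : set V) (d : V -> V -> R) (f : V -> V).

(* Not the topological boundary [closure D `\` interior D] in general, but equal
   to it when D is open. *)
Definition frontier D : set V := closure D `\` D.

Definition closed_segment (x y : V) : set V :=
  [set (1 - t) *: x + t *: y | t in `[0, 1]].

(* Connectedness of the domain is implied by convexity. *)
Definition convex_domain D : Prop := [/\ D !=set0, open D & convex_set D].

Definition metric_on D d : Prop :=
  [/\ {in D &, forall x y, 0 <= d x y},
      {in D &, forall x y, d x y = 0 <-> x = y},
      {in D &, forall x y, d x y = d y x} &
      {in D & &, forall x y z, d x z <= d x y + d y z}].

Definition metric_open D d U : Prop :=
  U `<=` D /\
  forall x, U x -> exists2 r : R, 0 < r & forall y, D y -> d x y < r -> U y.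

Definition norm_relatively_open D U : Prop :=
  exists2 W, open W & U = W `&` D.

Definition same_topology D d : Prop :=
  forall U, metric_open D d U <-> norm_relatively_open D U.

Definition quasi_geodesic D d (kappa : R) : Prop :=
  forall x y, D x -> D y ->
  exists (a b : R) (gamma : R -> V),
    [/\ a <= b, gamma a = x & gamma b = y] /\
    [/\ set_fun `[a, b] D gamma,
        {within `[a, b], continuous gamma} &
        {in `[a, b] &, forall t1 t2,
           `|t1 - t2| - kappa <= d (gamma t1) (gamma t2) <= `|t1 - t2| + kappa}].

Definition axiom1' D d : Prop :=
  same_topology D d /\
  forall (w : V) (x : nat -> V) (p : V),
    D w -> (forall n, D (x n)) -> frontier D p -> x n @[n --> \oo] --> p ->
    d (x n) w @[n --> \oo] --> +oo.

Definition axiom2star D d : Prop :=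
  forall (x y : nat -> V) (p q : V),
    (forall n, D (x n)) -> (forall n, D (y n)) ->
    frontier D p -> frontier D q ->
    x n @[n --> \oo] --> p -> y n @[n --> \oo] --> q ->
    ~ (closed_segment p q `<=` frontier D) ->
    forall z, D z ->
    d (x n) (y n) - Num.max (d (x n) z) (d (y n) z) @[n --> \oo] --> +oo.

Definition nonexpansive D d f : Prop :=
  {in D &, forall x y, d (f x) (f y) <= d x y}.

Definition compact_map D f : Prop := compact (closure (f @` D)).

Definition metric_bounded d A : Prop :=
  exists M : R, forall x y, A x -> A y -> d x y <= M.

Definition orbit f (y : V) : set V := range (fun n => iter n f y).

Definition without_bounded_orbits D d f : Prop :=
  forall y, D y -> ~ metric_bounded d (orbit f y).

Definition omega_limit f (y : V) : set V :=
  [set x | exists2 n_ : nat -> nat,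
             increasing_seq n_ & iter (n_ k) f y @[k --> \oo] --> x].

Definition attractor D f : set V := \bigcup_(y in D) omega_limit f y.

Definition ch D (xi : V) : set V :=
  [set x | frontier D x /\ closed_segment x xi `<=` frontier D].

End definitions.

(* Main.v *)
(** Write [y_n = f^n(y)].  An orbit with an accumulation point in [D] is
    [d]-bounded (Calka's argument): by compactness the times at which it visits
    a fixed ball have bounded gaps, and between two visits nonexpansiveness
    controls the orbit.  Hence, all orbits being unbounded, the attractor lies
    in the frontier.  Fix [y] and choose record times [r_k] of the unbounded
    sequence [d(y_n, y)], along which [y_{r_k}] converges to some [xi] in the
    frontier.  If [f^{m_k}(z)] converges to [x], then, for [m <= r] with [r] a
    record time, [d(f^m(z), y_r) <= d(z, y) + d(y, y_{r - m})
    <= d(z, y) + d(y_r, y)], which is incompatible with Axiom 2* unless the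
    segment [[x, xi]] lies in the frontier. *)
Require Import Defs.
From mathcomp Require Import all_boot all_order all_algebra.
From mathcomp Require Import all_classical all_reals all_analysis.
From mathcomp Require Import lra.
Set Implicit Arguments.
Unset Strict Implicit.
Import Order.TTheory GRing.Theory Num.Theory.
Import numFieldNormedType.Exports.
Local Open Scope classical_set_scope.
Local Open Scope ring_scope.

(** * Subsequences *)

Lemma cvgny_ge_id (s : nat -> nat) :
  (forall n, (n <= s n)%N) -> s n @[n --> \oo] --> \oo.
Proof.
move=> s_ge; apply/cvgnyPge => A; near=> n.
by apply: leq_trans (s_ge n); near: n; exact: nbhs_infty_ge.
Unshelve. all: by end_near. Qed.

Lemma increasing_seq_ge_id (s : nat -> nat) (n : nat) :
  increasing_seq s -> (n <= s n)%N.
Proof.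
move=> /increasing_seqP s_incr; elim: n => // n IHn.
exact: leq_ltn_trans IHn (s_incr n).
Qed.

(** Each [s n] is chosen separately, within [n.+1%:R^-1] of a cluster point, so [s] need not be
    monotone; [n <= s n] keeps it cofinal. *)
Lemma compact_cvg_subseq (R : realType) (V : normedModType R) (K : set V)
    (u : nat -> V) :
  compact K -> (forall n, K (u n)) ->
  exists2 q, K q &
    exists2 s : nat -> nat, (forall n, (n <= s n)%N) &
      u (s n) @[n --> \oo] --> q.
Proof.
move=> K_compact Ku.
have [|q [Kq u_q]] := K_compact (u n @[n --> \oo]) _.
  by exists 0%N => // n _; exact: Ku.
exists q => //.
have near_q n : exists k, (n <= k)%N /\ `|q - u k| < n.+1%:R^-1.
  have tail : (u @ \oo) [set u k | k in [set k | (n <= k)%N]].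
    by exists n => // k /= nk; exists k.
  have ball_q : nbhs q (ball q (n.+1%:R^-1 : R)).
    by apply: nbhsx_ballx; rewrite invr_gt0.
  have [_ [[k /= nk <-]]] := u_q _ _ tail ball_q.
  by rewrite -ball_normE /= => qk; exists k.
have [s s_near] := choice near_q.
exists s => [n|]; first by case: (s_near n).
apply/cvgrPdist_lt => e e0; near=> n.
apply: lt_trans (s_near n).2 _.
by near: n; exact: near_infty_natSinv_lt (PosNum e0).
Unshelve. all: by end_near. Qed.

(** * The metric and its topology *)

Lemma metric_onC (R : realType) (V : completeNormedModType R) (D : set V)
    (d : V -> V -> R) (x y : V) :
  metric_on D d -> D x -> D y -> d x y = d y x.
Proof. by case=> _ _ dC _ Dx Dy; apply: dC; exact: mem_set. Qed.

Lemma metric_on_triangle (R : realType) (V : completeNormedModType R)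
    (D : set V) (d : V -> V -> R) (x y z : V) :
  metric_on D d -> D x -> D y -> D z -> d x z <= d x y + d y z.
Proof. by case=> _ _ _ dT Dx Dy Dz; apply: dT; exact: mem_set. Qed.

Lemma metric_on_refl (R : realType) (V : completeNormedModType R)
    (D : set V) (d : V -> V -> R) (x : V) :
  metric_on D d -> D x -> d x x = 0.
Proof. by case=> _ d0 _ _ Dx; apply/d0 => //; exact: mem_set. Qed.

Lemma metric_bounded_range (R : realType) (V : completeNormedModType R)
    (D : set V) (d : V -> V -> R) (u : nat -> V) (w : V) (C : R) :
  metric_on D d -> D w -> (forall n, D (u n)) -> (forall n, d (u n) w <= C) ->
  metric_bounded d (range u).
Proof.
move=> dm Dw Du uC; exists (C + C) => _ _ [m _ <-] [n _ <-].
apply: le_trans (metric_on_triangle dm (Du m) Dw (Du n)) _.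
by rewrite (metric_onC dm Dw (Du n)) lerD.
Qed.

(** The [d]-ball about [q] is [metric_open] by the triangle inequality, hence the trace on [D] of a
    norm-open set. *)
Lemma same_topology_cvg (R : realType) (V : completeNormedModType R)
    (D : set V) (d : V -> V -> R) (x : nat -> V) (q : V) (e : R) :
  metric_on D d -> same_topology D d -> (forall n, D (x n)) -> D q -> 0 < e ->
  x n @[n --> \oo] --> q -> \forall n \near \oo, d (x n) q < e.
Proof.
move=> dm dtop Dx Dq e0 x_q.
have [|W W_open ballE] := (dtop [set y | D y /\ d y q < e]).1.
  split=> [y []//|y [Dy yq]]; exists (e - d y q); first by rewrite subr_gt0.
  move=> z Dz yz; split=> //.
  apply: le_lt_trans (metric_on_triangle dm Dz Dy Dq) _.
  by rewrite (metric_onC dm Dz Dy) -ltrBrDr.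
have Wq : W q.
  have : [set y | D y /\ d y q < e] q by split; rewrite // (metric_on_refl dm).
  by rewrite ballE => -[].
have : \forall n \near \oo, W (x n) by apply: x_q; exact: open_nbhs_nbhs.
apply: filterS => n Wx.
by have [] : [set y | D y /\ d y q < e] (x n) by rewrite ballE; split.
Qed.

(** * Orbits and their accumulation points in the domain *)

Lemma set_fun_iter (T : Type) (D : set T) (f : T -> T) (n : nat) :
  set_fun D D f -> set_fun D D (iter n f).
Proof. by move=> fD x Dx; elim: n => //= n; exact: fD. Qed.

Lemma nonexpansive_iter (R : realType) (V : completeNormedModType R)
    (D : set V) (d : V -> V -> R) (f : V -> V) (n : nat) (x y : V) :
  set_fun D D f -> nonexpansive D d f -> D x -> D y ->
  d (iter n f x) (iter n f y) <= d x y.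
Proof.
move=> fD f_ne Dx Dy; elim: n => //= n; apply: le_trans.
by apply: f_ne; apply: mem_set; exact: set_fun_iter.
Qed.

Lemma compact_orbit_subseq (R : realType) (V : completeNormedModType R)
    (D : set V) (f : V -> V) (z : V) (t : nat -> nat) :
  set_fun D D f -> compact_map D f -> D z -> (forall n, (0 < t n)%N) ->
  exists2 q, closure D q &
    exists2 s : nat -> nat, (forall n, (n <= s n)%N) &
      iter (t (s n)) f z @[n --> \oo] --> q.
Proof.
move=> fD f_compact Dz t_gt0.
have Dit n : D (iter n f z) by exact: set_fun_iter.
have [|q Kq s_q] := compact_cvg_subseq (u := fun n => iter (t n) f z) f_compact.
  move=> n; apply: subset_closure; case: (t n) (t_gt0 n) => // k _.
  by exists (iter k f z).
by exists q => //; apply: closureS Kq => _ [w Dw <-]; exact: fD.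
Qed.

Lemma axiom1'_bounded_cvg (R : realType) (V : completeNormedModType R)
    (D : set V) (d : V -> V -> R) (x : nat -> V) (q w : V) (C : R) :
  axiom1' D d -> (forall n, D (x n)) -> closure D q -> D w ->
  x n @[n --> \oo] --> q -> (forall n, d (x n) w <= C) -> D q.
Proof.
move=> [_ dy] Dx clq Dw x_q xC; apply: contrapT => NDq.
have /cvgryPgt/(_ C)[N _ NC] := dy w x q Dw Dx (conj clq NDq) x_q.
by have := NC N (leqnn N); rewrite ltNge xC.
Qed.

(* Otherwise there are visits [z_{n_k}] followed by ever longer absences.  They
   subconverge to a point [q] of [D], which some [p] steps of the orbit bring
   close to [x]; by nonexpansiveness the same [p] works for all large [k]. *)
Lemma return_times_bounded (R : realType) (V : completeNormedModType R)
    (D : set V) (d : V -> V -> R) (f : V -> V) (z x : V) :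
  metric_on D d -> axiom1' D d -> set_fun D D f -> nonexpansive D d f ->
  compact_map D f -> D z -> D x -> omega_limit f z x ->
  exists N : nat, forall n, (0 < n)%N -> d (iter n f z) x < 1 ->
    exists p, (0 < p <= N)%N /\ d (iter (p + n) f z) x < 1.
Proof.
move=> dm ax1 fD f_ne f_compact Dz Dx [m m_incr m_x].
have Dit n : D (iter n f z) by exact: set_fun_iter.
apply: contrapT => H.
have absence N : exists n, [/\ (0 < n)%N, d (iter n f z) x < 1 &
    forall p, (0 < p <= N)%N -> 1 <= d (iter (p + n) f z) x].
  apply: contrapT => HN; apply: H; exists N => n n0 nx.
  apply: contrapT => Hn; apply: HN; exists n; split=> // p pN.
  by rewrite leNgt; apply/negP => px; apply: Hn; exists p.
have [t t_abs] := choice absence.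
have [|q clq [s s_ge s_q]] :=
  compact_orbit_subseq (t := t) fD f_compact Dz.
  by move=> n; case: (t_abs n).
have Dq : D q.
  apply: (axiom1'_bounded_cvg (C := 1) ax1 _ clq Dx s_q) => // n.
  by case: (t_abs (s n)) => _ /ltW.
(* Three errors of a quarter add up below 1: two from comparing visits near [q], one from the
   approach to [x]. *)
have e0 : 0 < 4^-1 :> R by lra.
have [N1 _ N1q] := same_topology_cvg dm ax1.1 (fun n => Dit _) Dq e0 s_q.
have [N2 _ N2x] := same_topology_cvg dm ax1.1 (fun n => Dit _) Dx e0 m_x.
(* The visit [k] near [q] is fixed first, and [p] leads from it to a time [m i] near [x]. Then [j]
   is taken so large that the absence after [t (s j)] lasts at least [p] steps. *)
pose k := t (s N1); pose i := maxn N2 k.+1.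
have ki : (k < m i)%N.
  by apply: leq_trans (increasing_seq_ge_id i m_incr); exact: leq_maxr.
pose p := (m i - k)%N; pose j := maxn N1 p.
have [_ _ /(_ p)] := t_abs (s j).
rewrite /p subn_gt0 ki -/p (leq_trans (leq_maxr N1 p) (s_ge j)).
move=> /(_ isT); apply/negP; rewrite -ltNge.
have jq : d (iter (t (s j)) f z) q < 4^-1 by apply: N1q; exact: leq_maxl.
have kq : d (iter k f z) q < 4^-1 by apply: (N1q N1); exact: leqnn.
have ix : d (iter (p + k) f z) x < 4^-1.
  by rewrite subnK; [apply: N2x; exact: leq_maxl | exact: ltnW].
have jk := metric_on_triangle dm (Dit (t (s j))) Dq (Dit k).
have pjk := nonexpansive_iter p fD f_ne (Dit (t (s j))) (Dit k).
have := metric_on_triangle dm (Dit (p + t (s j))%N) (Dit (p + k)%N) Dx.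
rewrite (metric_onC dm Dq (Dit k)) in jk; rewrite -!iterD in pjk.
lra.
Qed.

Lemma omega_limit_bounded_orbit (R : realType) (V : completeNormedModType R)
    (D : set V) (d : V -> V -> R) (f : V -> V) (z x : V) :
  metric_on D d -> axiom1' D d -> set_fun D D f -> nonexpansive D d f ->
  compact_map D f -> D z -> D x -> omega_limit f z x ->
  metric_bounded d (Defs.orbit f z).
Proof.
move=> dm ax1 fD f_ne f_compact Dz Dx zx.
have Dit n : D (iter n f z) by exact: set_fun_iter.
have [N returns] := return_times_bounded dm ax1 fD f_ne f_compact Dz Dx zx.
case: zx => m m_incr m_x.
have [N2 _ N2x] := same_topology_cvg dm ax1.1 (fun n => Dit _) Dx ltr01 m_x.
(* The successor makes [n0] positive, as [returns] requires of a visit. *)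
pose n0 := m N2.+1.
have n0_gt0 : (0 < n0)%N.
  exact: leq_trans (increasing_seq_ge_id N2.+1 m_incr).
have n0x : d (iter n0 f z) x < 1 by apply: N2x => /=.
(* In the induction the delay [p] grows until it reaches [N]; then the reference visit [k] is
   replaced by the next one, [i + k]. *)
have last_visit n : (n0 <= n)%N ->
    exists k p, [/\ n = (p + k)%N, (0 < k)%N, (p <= N)%N &
      d (iter k f z) x < 1].
  elim: n => [|n IHn]; first by rewrite leqNgt n0_gt0.
  rewrite leq_eqVlt => /predU1P[<-|/IHn[k [p [-> k0 pN kx]]]].
    by exists n0, 0%N.
  case: (ltnP p N) => [pN'|Np]; first by exists k, p.+1.
  have [i [/andP[i0 iN] ix]] := returns k k0 kx.
  exists (i + k)%N, (p.+1 - i)%N; split=> //.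
  - by rewrite addnA subnK// (leq_trans iN)// (leq_trans Np).
  - by rewrite addn_gt0 i0.
  - by rewrite leq_subLR (leq_trans (_ : p.+1 <= 1 + N)%N)// leq_add.
pose a i := d (iter i f z) z; pose b i := d (iter i f z) x.
(* From [n0] on, the first maximum bounds the drift since a visit and 1 the distance of that visit
   from [x]; the last maximum covers the earlier times. The default 0 keeps both maxima
   nonnegative. *)
pose C := \big[Num.max/0]_(i < N.+1) a i + 1 + \big[Num.max/0]_(i < n0) b i.
have max_a0 : 0 <= \big[Num.max/0]_(i < N.+1) a i by exact: bigmax_ge_id.
have max_b0 : 0 <= \big[Num.max/0]_(i < n0) b i by exact: bigmax_ge_id.
apply: (metric_bounded_range (C := C) dm Dx) => // n.
case: (ltnP n n0) => [nn0|/last_visit[k [p [-> _ pN kx]]]].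
  have : b n <= \big[Num.max/0]_(i < n0) b i.
    exact: (le_bigmax _ (fun i : 'I_n0 => b i) (Ordinal nn0)).
  rewrite /C /b; lra.
have ap : a p <= \big[Num.max/0]_(i < N.+1) a i.
  exact: (le_bigmax _ (fun i : 'I_N.+1 => a i) (Ordinal (pN : (p < N.+1)%N))).
have pk := nonexpansive_iter k fD f_ne (Dit p) Dz.
rewrite -iterD addnC in pk.
have := metric_on_triangle dm (Dit (p + k)%N) (Dit k) Dx.
rewrite /C; rewrite /a in ap *; lra.
Qed.

(** * Record times and the attractor *)

(** Take the first index where [a] exceeds both [k] and its values up to [k]: all earlier values lie
    below that threshold. *)
Lemma record_time (R : realType) (a : nat -> R) (k : nat) :
  (forall C, exists n, C < a n) ->
  exists n, [/\ (k < n)%N, k%:R < a n & forall i, (i <= n)%N -> a i <= a n].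
Proof.
move=> a_unbounded.
pose M := Num.max k%:R (\big[Num.max/0]_(i < k.+1) a i).
have [n Mn n_min] := ex_minnP (a_unbounded M).
exists n; split=> [||i].
- rewrite ltnNge; apply/negP => nk; move: Mn; apply/negP; rewrite -leNgt.
  rewrite /M le_max; apply/orP; right.
  exact: (le_bigmax _ (fun i : 'I_k.+1 => a i) (Ordinal (nk : (n < k.+1)%N))).
- by apply: le_lt_trans Mn; rewrite /M le_max lexx.
- rewrite leq_eqVlt => /predU1P[->//|i_n]; apply: le_trans (ltW Mn).
  by rewrite leNgt; apply/negP => /n_min; rewrite leqNgt i_n.
Qed.

Unset Implicit Arguments.

Theorem theorem4p6 (R : realType) (V : completeNormedModType R)
    (D : set V) (d : V -> V -> R) (kappa : R) (f : V -> V)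
    (D_domain : convex_domain D) (D_bounded : bounded_set D)
    (d_metric : metric_on D d)
    (kappa_ge0 : 0 <= kappa) (d_quasi_geodesic : quasi_geodesic D d kappa)
    (d_axiom1 : axiom1' D d) (d_axiom2 : axiom2star D d)
    (f_D : set_fun D D f) (f_nonexpansive : nonexpansive D d f)
    (f_compact : compact_map D f)
    (f_unbounded : without_bounded_orbits D d f) :
  exists2 xi : V, frontier D xi & attractor D f `<=` ch D xi.
Proof.
have [[y Dy] _ _] := D_domain.
have Dit z n : D z -> D (iter n f z) by exact: set_fun_iter.
pose a n := d (iter n f y) y.
have a_unbounded C : exists n, C < a n.
  apply: contrapT => aC; apply: (f_unbounded _ Dy).
  apply: (metric_bounded_range (C := C) d_metric Dy) => n; first exact: Dit.
  by rewrite leNgt; apply/negP => Cn; apply: aC; exists n.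
have [r r_record] := choice (fun k => @record_time R a k a_unbounded).
have [|xi cl_xi [s s_ge s_xi]] :=
  compact_orbit_subseq (t := r) f_D f_compact Dy.
  by move=> k; case: (r_record k) => /(leq_ltn_trans (leq0n k)).
(* Near a point of [D] the distances to [y] would stay bounded, whereas the record values exceed
   every [k]. *)
have NDxi : ~ D xi.
  move=> Dxi.
  have [N _ Nxi] := same_topology_cvg d_metric d_axiom1.1
    (fun n => Dit _ _ Dy) Dxi ltr01 s_xi.
  have [k kC] : exists k : nat, 1 + d xi y <= k%:R :> R.
    exists (Num.bound `|1 + d xi y|).
    by apply: le_trans (ler_norm _) _; rewrite ltW// archi_boundP.
  have := Nxi (maxn N k) (leq_maxl _ _).
  set n := r _ => nxi.
  have [_ kn _] := r_record (s (maxn N k)); rewrite -/n in kn.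
  have : k%:R <= (s (maxn N k))%:R :> R.
    by rewrite ler_nat (leq_trans (leq_maxr N k)).
  have := metric_on_triangle d_metric (Dit _ n Dy) Dxi Dy.
  rewrite /a in kn; lra.
exists xi => // x [z Dz zx].
have [m m_incr m_x] := zx.
have cl_x : closure D x.
  apply: (closed_cvg _ (@closed_closure _ D) _ _ m_x).
  by near=> k; apply: subset_closure; exact: Dit.
have fr_x : frontier D x.
  split=> // Dx; apply: (f_unbounded _ Dz).
  exact: (omega_limit_bounded_orbit d_metric d_axiom1 f_D f_nonexpansive
    f_compact Dz Dx zx).
split=> //; apply: contrapT => Nseg.
have m_ge k := increasing_seq_ge_id k m_incr.
(* Indexing the records by [m k] ensures [m k <= r (s (m k))], so that the first [m k] steps can be
   cancelled. *)
have sm_xi : iter (r (s (m k))) f y @[k --> \oo] --> xi.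
  exact: (cvg_comp m _ (cvgny_ge_id m_ge) s_xi).
(* The record property keeps the difference in Axiom 2* at most [d z y], so exceeding this value
   once is contradictory. *)
have /cvgryPgt/(_ (d z y))[K _ KC] := d_axiom2 _ _ _ _
  (fun k => Dit _ (m k) Dz) (fun k => Dit _ (r (s (m k))) Dy)
  fr_x (conj cl_xi NDxi) m_x sm_xi Nseg y Dy.
have := KC K (leqnn K); apply/negP; rewrite -leNgt.
set n := m K.
have [n_r _ r_max] := r_record (s n).
have le_nr : (n <= r (s n))%N by rewrite (leq_trans (s_ge n))// ltnW.
have zy := nonexpansive_iter n f_D f_nonexpansive Dz Dy.
have yy := nonexpansive_iter n f_D f_nonexpansive Dy (Dit _ (r (s n) - n)%N Dy).
rewrite -iterD subnKC// in yy.
rewrite (metric_onC d_metric Dy (Dit _ _ Dy)) in yy.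
have a_le := r_max _ (leq_subr n (r (s n))).
have tri := metric_on_triangle d_metric (Dit z n Dz) (Dit y n Dy)
  (Dit y (r (s n)) Dy).
have le_max_r : a (r (s n)) <=
    Num.max (d (iter n f z) y) (d (iter (r (s n)) f y) y).
  by rewrite le_max lexx orbT.
rewrite /a in a_le le_max_r; lra.
Unshelve. all: by end_near. Qed.
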